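(* Let $G$ be a solvable group generated by a finite set $X$, and let $A$ be a normal abelian subgroup of $G$ such that $G/A$ satisfies the maximal condition for normal subgroups. Then $\mathrm{pw}(G,X)<\infty$.
   Context: For a group $G$ generated by a set $X$, a palindrome is an element of $G$ represented by a reduced word in the alphabet $X^{\pm1}$ that reads the same forwards and backwards. The palindromic length $l_{\mathcal P}(g)$ of $g\in G$ is the minimal $k$ such that $g$ is a product of $k$ palindromes, and the palindromic width is $\mathrm{pw}(G,X)=\sup_{g\in G} l_{\mathcal P}(g)$. A group satisfies the maximal condition for normal subgroups if every normal subgroup is the normal closure of a finite subset. *)

(* Defs.v *)
From Stdlib Require Import List.
Import ListNotations.
Set Implicit Arguments.


Record group := Group {
  carrier :> Type;
  mul : carrier -> carrier -> carrier;
  one : carrier;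
  inv : carrier -> carrier;
  mulA : forall x y z, mul x (mul y z) = mul (mul x y) z;
  mul1g : forall x, mul one x = x;
  mulVg : forall x, mul (inv x) x = one
}.

Arguments mul {g} _ _.
Arguments inv {g} _.
Arguments one {g}.

Section Defs.
Variable G : group.

Definition prodg (l : list G) : G := fold_right (@mul G) (@one G) l.

Definition letter := (G * bool)%type.
Definition eval_letter (a : letter) : G :=
  if snd a then inv (fst a) else fst a.
Definition eval_word (w : list letter) : G := prodg (map eval_letter w).

Definition word_over (X : G -> Prop) (w : list letter) : Prop :=
  Forall (fun a => X (fst a)) w.

Fixpoint reduced (w : list letter) : Prop :=
  match w with
  | a :: ((b :: _) as t) => ~ (fst a = fst b /\ snd b = negb (snd a)) /\ reduced t
  | _ => True
  end.

Definition palindrome (X : G -> Prop) (g : G) : Prop :=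
  exists w, word_over X w /\ reduced w /\ rev w = w /\ eval_word w = g.

Definition pw_finite (X : G -> Prop) : Prop :=
  exists N : nat, forall g : G,
    exists ps : list G, length ps <= N /\ Forall (palindrome X) ps /\ prodg ps = g.

Definition finite_set (X : G -> Prop) : Prop :=
  exists l : list G, forall x, X x <-> In x l.

Definition generates (X : G -> Prop) : Prop :=
  forall g : G, exists w, word_over X w /\ eval_word w = g.

Inductive gen (S : G -> Prop) : G -> Prop :=
  | gen_in : forall x, S x -> gen S x
  | gen_one : gen S (@one G)
  | gen_mul : forall x y, gen S x -> gen S y -> gen S (mul x y)
  | gen_inv : forall x, gen S x -> gen S (inv x).

Definition conjg (x g : G) : G := mul (inv g) (mul x g).
Definition commg (x y : G) : G := mul (inv x) (mul (inv y) (mul x y)).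

Fixpoint derived (n : nat) : G -> Prop :=
  match n with
  | O => fun _ => True
  | S m => gen (fun c => exists a b, derived m a /\ derived m b /\ c = commg a b)
  end.

Definition solvable : Prop := exists n, forall g, derived n g -> g = @one G.

Definition subgroup (H : G -> Prop) : Prop :=
  H (@one G) /\ (forall x y, H x -> H y -> H (mul x y)) /\ (forall x, H x -> H (inv x)).

Definition normal (H : G -> Prop) : Prop :=
  subgroup H /\ forall x g, H x -> H (conjg x g).

Definition abelian_sub (H : G -> Prop) : Prop :=
  forall x y, H x -> H y -> mul x y = mul y x.

Definition normal_closure (S : G -> Prop) : G -> Prop :=
  gen (fun y => exists x g, S x /\ y = conjg x g).

(* G/A satisfies the maximal condition for normal subgroups, expressed through
   the correspondence theorem: every normal subgroup N of G containing A is the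
   normal closure (in G) of A together with finitely many elements; i.e. N/A is
   the normal closure in G/A of a finite subset. *)
Definition quotient_max_n (A : G -> Prop) : Prop :=
  forall N : G -> Prop, normal N -> (forall a, A a -> N a) ->
    exists l : list G, forall g, N g <-> normal_closure (fun x => A x \/ In x l) g.

End Defs.

Arguments palindrome {G} X g.
Arguments pw_finite {G} X.
Arguments finite_set {G} X.
Arguments generates {G} X.
Arguments normal {G} H.
Arguments subgroup {G} H.
Arguments abelian_sub {G} H.
Arguments normal_closure {G} S _.
Arguments quotient_max_n {G} A.

(* Main.v *)
(* If [h] is the value of the reversal of a word for [g], then a palindrome [p] satisfies
   [g^-1 p g = (g^-1 p h^-1) (h g)], a product of two palindromes; hence for fixed [c] all
   commutators [[n, c]] are products of boundedly many palindromes. Put [D = [A, G]] and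
   [N = G^(i)]. Modulo the normal subgroup [[N', G] N'' D] the subgroup [N'] is central and
   [A] is central, so [N'] is the product of the sets [[N, c_j]], where the [c_j] are
   finitely many normal generators of [N A] modulo [A]. If a normal subgroup [M] is abelian
   modulo [R], then [[M, G]] is modulo [R] the product of the sets [[M, x]] over the
   generators [x]; this bounds [[N', G]] modulo [N'' D], and [D] itself. As [G / G'] is
   bounded too, descending the derived series gives the theorem. *)
Require Import Defs.
From Stdlib Require Import List Lia Classical Setoid Morphisms.
Import ListNotations.

Local Arguments derived {G} n _.
Local Arguments gen {G} S _.
Local Arguments conjg {G} x g.
Local Arguments commg {G} x y.
Local Arguments prodg {G} l.
Local Infix "*" := mul.

(** * Elementary group identities and a normalizing rewrite base *)

Section Group.
Variable G : group.
Implicit Types x y z g : G.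

Lemma mulKg x y : inv x * (x * y) = y.
Proof. now rewrite mulA, mulVg, mul1g. Qed.

Lemma mulg_injl x y z : x * y = x * z -> y = z.
Proof. intros H. now rewrite <- (mulKg x y), H, mulKg. Qed.

Lemma mulg1 x : x * one = x.
Proof. apply (mulg_injl (inv x)). now rewrite mulA, mulVg, mul1g. Qed.

Lemma mulgV x : x * inv x = one.
Proof. apply (mulg_injl (inv x)). now rewrite mulKg, mulg1. Qed.

Lemma mulVKg x y : x * (inv x * y) = y.
Proof. now rewrite mulA, mulgV, mul1g. Qed.

Lemma invg_unique x y : x * y = one -> y = inv x.
Proof. intros H. apply (mulg_injl x). now rewrite H, mulgV. Qed.

Lemma invgK x : inv (inv x) = x.
Proof. symmetry. apply invg_unique, mulVg. Qed.

Lemma invMg x y : inv (x * y) = inv y * inv x.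
Proof. symmetry. apply invg_unique. now rewrite <- mulA, mulVKg, mulgV. Qed.

Lemma invg1 : inv one = @one G.
Proof. symmetry. apply invg_unique, mul1g. Qed.

End Group.

Hint Rewrite mul1g mulg1 mulVg mulgV mulKg mulVKg invgK invMg invg1 : grp.
Hint Rewrite <- mulA : grp.
Ltac grp := unfold conjg, commg; autorewrite with grp; try reflexivity.

(** * Palindromes, mirrors and products of boundedly many palindromes *)

Section Words.
Variable G : group.

Lemma eval_word_app (u v : list (letter G)) :
  eval_word (u ++ v) = eval_word u * eval_word v.
Proof.
  unfold eval_word. induction u as [|a u IH]; simpl.
  - now rewrite mul1g.
  - rewrite IH. apply mulA.
Qed.

Definition cancels (a b : letter G) : Prop := fst a = fst b /\ snd b = negb (snd a).

Lemma eval_cancels a b : cancels a b -> eval_letter b = inv (eval_letter a).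
Proof.
  destruct a as [x s], b as [y t]; unfold eval_letter; intros [E1 E2]; simpl in *; subst.
  destruct s; simpl; now rewrite ?invgK.
Qed.

Lemma cancels_sym a b : cancels a b -> cancels b a.
Proof.
  intros [E1 E2]; split; [easy|]. rewrite E2. now destruct (snd a).
Qed.

Lemma reduced_app_l (u v : list (letter G)) : reduced (u ++ v) -> reduced u.
Proof.
  induction u as [|a [|b u] IH]; simpl; auto.
  intros [H1 H2]. split; [exact H1|exact (IH H2)].
Qed.

Lemma reduced_tail (a : letter G) u : reduced (a :: u) -> reduced u.
Proof. destruct u; simpl; tauto. Qed.

Lemma reduced_snoc (u : list (letter G)) a b :
  reduced (u ++ [a]) -> ~ cancels a b -> reduced (u ++ [a; b]).
Proof.
  induction u as [|c [|d u] IH]; simpl.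
  - auto.
  - intros [H1 H2] H3. auto.
  - intros [H1 H2] H3. split; [exact H1|exact (IH H2 H3)].
Qed.

Variable X : G -> Prop.

Lemma palindrome_one : palindrome X one.
Proof. exists []. repeat split; constructor. Qed.

Lemma palindrome_letter (a : letter G) : X (fst a) -> palindrome X (eval_letter a).
Proof.
  intros Ha. exists [a]. repeat split; [now repeat constructor|].
  unfold eval_word; simpl. apply mulg1.
Qed.

(* Either the sandwiched word is reduced, or its outer letters cancel
   simultaneously at both ends. *)
Lemma palindrome_sandwich (a : letter G) p :
  X (fst a) -> palindrome X p ->
  palindrome X (eval_letter a * p * eval_letter a).
Proof.
  intros Ha (w & Hw & Hr & Hpal & <-).
  destruct w as [|b t].
  { exists [a; a]. split; [now repeat constructor|]. split.
    - split; [|exact I]. intros [_ E]. now destruct (snd a).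
    - split; [easy|]. unfold eval_word; simpl. now rewrite !mulg1. }
  destruct (classic (cancels a b)) as [Hc|Hc].
  - destruct t as [|c t].
    + unfold eval_word; simpl. rewrite (eval_cancels _ _ Hc).
      autorewrite with grp. now apply palindrome_letter.
    + destruct (@exists_last _ (c :: t)) as (q & d & Hq); [easy|].
      rewrite Hq in *. clear c t Hq. simpl in Hpal.
      rewrite rev_app_distr in Hpal. simpl in Hpal.
      (* Comparing the word with its reversal forces the last letter to be [b] and makes [q] its own
         reversal, so stripping both ends leaves a reduced palindrome. *)
      injection Hpal as -> Hpal. apply app_inj_tail in Hpal as [Hpal _].
      exists q. split; [|split; [|split]].
      * inversion_clear Hw as [|? ? _ Hw']. now apply Forall_app in Hw'.
      * eapply reduced_app_l, reduced_tail, Hr.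
      * exact Hpal.
      * change (b :: q ++ [b]) with ([b] ++ q ++ [b]).
        rewrite !eval_word_app. unfold eval_word at 2 4. simpl.
        rewrite (eval_cancels _ _ Hc). now autorewrite with grp.
  - exists (a :: (b :: t) ++ [a]). split; [|split; [|split]].
    + constructor; [easy|]. apply Forall_app; split; [easy|]. now repeat constructor.
    + split; [exact Hc|]. change (b :: t ++ [a]) with ((b :: t) ++ [a]).
      (* The word is replaced by its reversal, which ends visibly in [b]; this is the letter that
         the appended [a] must not cancel. *)
      rewrite <- Hpal in Hr |- *. simpl in Hr |- *. rewrite <- app_assoc. simpl.
      apply reduced_snoc; [easy|]. intros H. now apply Hc, cancels_sym.
    + change (a :: (b :: t) ++ [a]) with ([a] ++ (b :: t) ++ [a]).
      now rewrite !rev_app_distr, Hpal, <- app_assoc.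
    + change (a :: (b :: t) ++ [a]) with ([a] ++ (b :: t) ++ [a]).
      rewrite !eval_word_app. unfold eval_word at 1 3. simpl. now autorewrite with grp.
Qed.

Hypothesis HX : generates X.

Lemma palindrome_sandwich_gen x p : X x -> palindrome X p ->
  palindrome X (x * p * x) /\ palindrome X (inv x * p * inv x).
Proof.
  intros Hx Hp. split.
  - exact (palindrome_sandwich (x, false) p Hx Hp).
  - exact (palindrome_sandwich (x, true) p Hx Hp).
Qed.

(** Inverse letters get their own case because [X] need not be closed under inverses. *)
Lemma word_ind (P : G -> Prop) :
  P one ->
  (forall x g, X x -> P g -> P (x * g)) ->
  (forall x g, X x -> P g -> P (inv x * g)) ->
  forall g, P g.
Proof.
  intros H1 H2 H3 g. destruct (HX g) as (w & Hw & <-).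
  induction Hw as [|[x []] w Hx Hw IH]; [exact H1| |]; unfold eval_word; simpl.
  - now apply H3.
  - now apply H2.
Qed.

(* [h] is the value of the reversal of a word for [g]. *)
Lemma exists_mirror g : exists h, forall p, palindrome X p ->
  palindrome X (g * p * h) /\ palindrome X (h * p * g) /\
  palindrome X (inv g * p * inv h) /\ palindrome X (inv h * p * inv g).
Proof.
  revert g. apply word_ind.
  - exists one. intros p Hp. autorewrite with grp. auto.
  (* Reversal moves the new letter to the other end, so the mirror of [x * g] is [h * x]. In the
     first and fourth forms [x] lands outside and the sandwich comes last; in the other two it lands
     next to [p] and the sandwich comes first. *)
  - intros x g Hx [h Hh]. exists (h * x). intros p Hp.
    destruct (Hh p Hp) as (A1 & A2 & A3 & A4).
    destruct (palindrome_sandwich_gen x p Hx Hp) as [B1 B2].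
    destruct (Hh _ B1) as (_ & C2 & _). destruct (Hh _ B2) as (_ & _ & C3 & _).
    destruct (palindrome_sandwich_gen x _ Hx A1) as [D1 _].
    destruct (palindrome_sandwich_gen x _ Hx A4) as [_ D2].
    autorewrite with grp in *. auto.
  - intros x g Hx [h Hh]. exists (h * inv x). intros p Hp.
    destruct (Hh p Hp) as (A1 & A2 & A3 & A4).
    destruct (palindrome_sandwich_gen x p Hx Hp) as [B1 B2].
    destruct (Hh _ B2) as (_ & C2 & _). destruct (Hh _ B1) as (_ & _ & C3 & _).
    destruct (palindrome_sandwich_gen x _ Hx A1) as [_ D1].
    destruct (palindrome_sandwich_gen x _ Hx A4) as [D2 _].
    autorewrite with grp in *. auto.
Qed.

Definition pal_prod (k : nat) (g : G) : Prop :=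
  exists ps, length ps <= k /\ Forall (palindrome X) ps /\ prodg ps = g.

Lemma pal_prod_one k : pal_prod k one.
Proof. exists []. simpl. repeat split; [lia|constructor]. Qed.

Lemma pal_prod_palindrome p : palindrome X p -> pal_prod 1 p.
Proof. intros Hp. exists [p]. simpl. repeat split; [lia|auto|apply mulg1]. Qed.

Lemma pal_prod_mul j k g h : pal_prod j g -> pal_prod k h -> pal_prod (j + k) (g * h).
Proof.
  intros (ps & L1 & F1 & <-) (qs & L2 & F2 & <-).
  exists (ps ++ qs). rewrite length_app, Forall_app. repeat split; auto; [lia|].
  clear. induction ps as [|p ps IH]; simpl.
  - now rewrite mul1g.
  - rewrite IH. apply mulA.
Qed.

(* With [h] the mirror of [g], [g^-1 p g = (g^-1 p h^-1) (h g)]. *)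
Lemma pal_prod_conj k p g : pal_prod k p -> pal_prod (k + k) (conjg p g).
Proof.
  intros (ps & L & F & <-). revert k L.
  induction F as [|p ps Hp F IH]; intros k L; simpl in *.
  - replace (conjg one g) with (@one G) by grp. apply pal_prod_one.
  - destruct k as [|k]; [lia|].
    destruct (exists_mirror g) as [h Hh].
    replace (conjg (p * prodg ps) g)
      with ((inv g * p * inv h) * (h * one * g) * conjg (prodg ps) g) by grp.
    replace (S k + S k) with (1 + 1 + (k + k)) by lia.
    apply pal_prod_mul; [apply pal_prod_mul; apply pal_prod_palindrome, Hh|apply IH; lia].
    + exact Hp.
    + apply palindrome_one.
Qed.

Lemma pal_prod_exists g : exists k, pal_prod k g.
Proof.
  revert g. apply word_ind.
  - exists 0. apply pal_prod_one.
  - intros x g Hx [k Hk]. exists (1 + k). apply pal_prod_mul; [|easy].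
    apply pal_prod_palindrome. exact (palindrome_letter (x, false) Hx).
  - intros x g Hx [k Hk]. exists (1 + k). apply pal_prod_mul; [|easy].
    apply pal_prod_palindrome. exact (palindrome_letter (x, true) Hx).
Qed.

(** [[g, c]] is the conjugate of [inv c] by [g], times [c]. Conjugation at most doubles the number
    of palindromes whatever [g] is, so the bound depends on [c] alone. *)
Lemma pal_prod_commg c : exists k, forall g, pal_prod k (commg g c).
Proof.
  destruct (pal_prod_exists c) as [i Hi]. destruct (pal_prod_exists (inv c)) as [j Hj].
  exists (j + j + i). intros g. replace (commg g c) with (conjg (inv c) g * c) by grp.
  apply pal_prod_mul; [now apply pal_prod_conj|easy].
Qed.

End Words.

(* Normal subgroups, made a class so that instance resolution supplies normality to rewriting modulo
   a subgroup *)
Existing Class normal.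

Section Normal.
Variable G : group.
Implicit Types R : G -> Prop.

Lemma normal_one R : normal R -> R one.
Proof. now intros [[H1 _] _]. Qed.

Lemma normal_mul R : normal R -> forall x y, R x -> R y -> R (x * y).
Proof. now intros [[_ [H2 _]] _]. Qed.

Lemma normal_inv R : normal R -> forall x, R x -> R (inv x).
Proof. now intros [[_ [_ H3]] _]. Qed.

Lemma normal_conj R : normal R -> forall x g, R x -> R (conjg x g).
Proof. now intros [_ H]. Qed.

End Normal.

Ltac in_normal :=
  repeat (assumption || match goal with
  | HR : normal ?R |- ?R one => apply (normal_one _ R HR)
  | HR : normal ?R |- ?R (_ * _) => apply (normal_mul _ R HR)
  | HR : normal ?R |- ?R (inv _) => apply (normal_inv _ R HR)
  | HR : normal ?R |- ?R (conjg _ _) => apply (normal_conj _ R HR)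
  end).

(** * Congruence modulo a normal subgroup, commutator identities and generated subgroups *)

Section Congruence.
Variable G : group.
Implicit Types H K M N R S : G -> Prop.

(** For normal [R] this is equality in the quotient by [R], expressed without constructing the
    quotient group. *)
Definition eqm R (x y : G) : Prop := R (inv x * y).

#[local] Instance eqm_equiv R {HR : normal R} : Equivalence (eqm R).
Proof.
  unfold eqm. split.
  - intros x. rewrite mulVg. now apply normal_one.
  - intros x y Hxy. apply (normal_inv _ R) in Hxy; [|easy]. now autorewrite with grp in Hxy.
  - intros x y z Hxy Hyz. pose proof (normal_mul _ R HR _ _ Hxy Hyz) as E.
    now autorewrite with grp in E.
Qed.

#[local] Instance eqm_mul R {HR : normal R} : Proper (eqm R ==> eqm R ==> eqm R) mul.
Proof.
  unfold eqm. intros x x' Hx y y' Hy.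
  replace (inv (x * y) * (x' * y')) with (conjg (inv x * x') y * (inv y * y')) by grp.
  apply normal_mul; [easy|now apply normal_conj|easy].
Qed.

#[local] Instance eqm_inv R {HR : normal R} : Proper (eqm R ==> eqm R) inv.
Proof.
  unfold eqm. intros x x' Hx.
  replace (inv (inv x) * inv x') with (conjg (inv (inv x * x')) (inv x)) by grp.
  now apply normal_conj, normal_inv.
Qed.

#[local] Instance eqm_conjg R {HR : normal R} : Proper (eqm R ==> eqm R ==> eqm R) conjg.
Proof. intros x x' Hx y y' Hy. unfold conjg. now rewrite Hx, Hy. Qed.

Lemma eqm_one R {HR : normal R} x : R x <-> eqm R x one.
Proof.
  unfold eqm. rewrite mulg1. split; intros Hx.
  - now apply normal_inv.
  - apply (normal_inv _ R) in Hx; [|easy]. now rewrite invgK in Hx.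
Qed.

Lemma eqm_conjg_commute R {HR : normal R} x y :
  eqm R (x * y) (y * x) -> eqm R (conjg x y) x.
Proof. intros E. unfold conjg. rewrite E. now autorewrite with grp. Qed.

Lemma eqm_commute_commg R {HR : normal R} x y :
  R (commg x y) -> eqm R (x * y) (y * x).
Proof.
  rewrite (eqm_one R). intros E.
  transitivity (y * x * commg x y); [now grp|]. rewrite E. now autorewrite with grp.
Qed.

Lemma eqm_commg_commute R {HR : normal R} x y :
  eqm R (x * y) (y * x) -> R (commg x y).
Proof. intros E. rewrite (eqm_one R). unfold commg. rewrite E. now autorewrite with grp. Qed.

Lemma commg_mulr (a x y : G) : commg a (x * y) = commg a y * conjg (commg a x) y.
Proof. grp. Qed.

Lemma commg_mull (a b x : G) : commg (a * b) x = conjg (commg a x) b * commg b x.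
Proof. grp. Qed.

Lemma commg_invl (a x : G) : commg (inv a) x = inv (conjg (commg a x) (inv a)).
Proof. grp. Qed.

Lemma commg_invr (a x : G) : commg a (inv x) = inv (conjg (commg a x) (inv x)).
Proof. grp. Qed.

Lemma subgroup_gen S : subgroup (gen S).
Proof. repeat split; [apply gen_one|apply gen_mul|apply gen_inv]. Qed.

Lemma gen_sub S K : subgroup K -> (forall x, S x -> K x) -> forall g, gen S g -> K g.
Proof. intros (K1 & K2 & K3) HS g Hg. induction Hg; auto. Qed.

Lemma normal_gen S : (forall x g, S x -> S (conjg x g)) -> normal (gen S).
Proof.
  intros HS. split; [apply subgroup_gen|]. intros x g Hx. induction Hx as [x Hx| |x y _ IHx _ IHy|x _ IHx].
  - now apply gen_in, HS.
  - replace (conjg one g) with (@one G) by grp. apply gen_one.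
  - replace (conjg (x * y) g) with (conjg x g * conjg y g) by grp. now apply gen_mul.
  - replace (conjg (inv x) g) with (inv (conjg x g)) by grp. now apply gen_inv.
Qed.

Definition prod_set H K (g : G) : Prop := exists h k, H h /\ K k /\ g = h * k.

#[local] Instance normal_prod_set H K {HH : normal H} {HK : normal K} : normal (prod_set H K).
Proof.
  repeat split.
  - exists one, one. repeat split; [in_normal|in_normal|grp].
  - intros x y (h & k & Hh & Hk & ->) (h' & k' & Hh' & Hk' & ->).
    exists (h * h'), (conjg k h' * k'). repeat split; [in_normal|in_normal|grp].
  - intros x (h & k & Hh & Hk & ->).
    exists (inv h), (conjg (inv k) (inv h)). repeat split; [in_normal|in_normal|grp].
  - intros x g (h & k & Hh & Hk & ->).
    exists (conjg h g), (conjg k g). repeat split; [in_normal|in_normal|grp].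
Qed.

Lemma prod_set_l H K h : normal K -> H h -> prod_set H K h.
Proof. intros HK Hh. exists h, one. repeat split; [easy|in_normal|grp]. Qed.

Lemma prod_set_r H K k : normal H -> K k -> prod_set H K k.
Proof. intros HH Hk. exists one, k. repeat split; [in_normal|easy|grp]. Qed.

(** The commutator subgroup [[M, G]]. *)
Definition comm_with_G M : G -> Prop :=
  gen (fun c => exists b g, M b /\ c = commg b g).

#[local] Instance normal_comm_with_G M {HM : normal M} : normal (comm_with_G M).
Proof.
  apply normal_gen. intros x h (b & g & Hb & ->).
  exists (conjg b h), (conjg g h). split; [now apply normal_conj|grp].
Qed.

#[local] Instance normal_derived n : normal (@derived G n).
Proof.
  induction n as [|n IH]; simpl.
  - now repeat split.
  - apply normal_gen. intros x h (a & b & Ha & Hb & ->).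
    exists (conjg a h), (conjg b h).
    repeat split; [now apply normal_conj|now apply normal_conj|grp].
Qed.

Lemma derived_succ_sub n (g : G) : derived (S n) g -> derived n g.
Proof.
  apply gen_sub; [apply normal_derived|]. intros x (a & b & Ha & Hb & ->).
  replace (commg a b) with (inv a * conjg a b) by grp.
  pose proof (normal_derived n). in_normal.
Qed.

(* The homomorphism [n |-> [n, c]] modulo [R] has a subgroup as image. *)
Lemma subgroup_commg_image R N K c : normal R -> subgroup N -> subgroup K ->
  (forall m n, N m -> N n -> eqm R (conjg (commg m c) n) (commg m c)) ->
  subgroup (fun g => K g /\ exists n, N n /\ eqm R g (commg n c)).
Proof.
  intros HR (N1 & N2 & N3) (K1 & K2 & K3) Hc. repeat split.
  - exact K1.
  - exists one. split; [exact N1|]. grp.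
  - destruct H as [Hx _], H0 as [Hy _]; auto.
  - destruct H as (_ & m & Hm & E), H0 as (_ & n & Hn & F).
    exists (m * n). split; [now apply N2|]. now rewrite E, F, commg_mull, Hc.
  - destruct H; auto.
  - destruct H as (_ & m & Hm & E). exists (inv m). split; [now apply N3|].
    now rewrite E, commg_invl, Hc by auto.
Qed.

End Congruence.

#[local] Existing Instances eqm_equiv eqm_mul eqm_inv eqm_conjg
  normal_prod_set normal_comm_with_G normal_derived.

(** * Boundedness by palindromes modulo a subgroup *)

Section Bounded.
Variables (G : group) (X : G -> Prop).
Hypothesis HX : generates X.
Implicit Types H K M N R S : G -> Prop.

(** The number [k] is uniform in [g]. With [S] the whole group and [R] trivial this is finiteness of
    the palindromic width. *)
Definition bounded_mod S R : Prop :=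
  exists k, forall g, S g -> exists p, pal_prod G X k p /\ eqm G R p g.

Lemma bounded_mod_refl R : bounded_mod R R.
Proof.
  exists 0. intros g Hg. exists one. split; [apply pal_prod_one|].
  unfold eqm. now autorewrite with grp.
Qed.

(** The error [inv p * g] of the first approximation lies in [R], so it can itself be approximated
    modulo [R']; the bounds add. *)
Lemma bounded_mod_trans S R R' : bounded_mod S R -> bounded_mod R R' -> bounded_mod S R'.
Proof.
  intros [j Hj] [k Hk]. exists (j + k). intros g Hg.
  destruct (Hj g Hg) as (p & Hp & E). destruct (Hk _ E) as (q & Hq & F).
  exists (p * q). split; [now apply pal_prod_mul|].
  unfold eqm in *. now autorewrite with grp in *.
Qed.

Lemma bounded_mod_sub S S' R : (forall x, S x -> S' x) -> bounded_mod S' R -> bounded_mod S R.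
Proof. intros HS [k Hk]. exists k. intros g Hg. now apply Hk, HS. Qed.

Lemma bounded_mod_sub_r S R R' : (forall x, R x -> R' x) -> bounded_mod S R -> bounded_mod S R'.
Proof.
  intros HS [k Hk]. exists k. intros g Hg. destruct (Hk g Hg) as (p & Hp & E).
  exists p. split; [easy|]. now apply HS.
Qed.

Lemma bounded_mod_prod_set S K R : normal R -> (forall x, K x -> R x) ->
  bounded_mod S R -> bounded_mod (prod_set G S K) R.
Proof.
  intros HR HK [k Hk]. exists k. intros g (s & r & Hs & Hr & ->).
  destruct (Hk s Hs) as (p & Hp & E). exists p. split; [easy|].
  rewrite E. unfold eqm. autorewrite with grp. auto.
Qed.

(** Inside [M], which is commutative modulo [R], finitely many subgroups generate their product
    modulo [R], so their bounds add up. *)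
Lemma bounded_mod_gen R M (Hs : list (G -> Prop)) : normal R ->
  (forall a b, M a -> M b -> eqm G R (a * b) (b * a)) -> subgroup M ->
  Forall (fun H => subgroup H /\ (forall a, H a -> M a) /\ bounded_mod H R) Hs ->
  bounded_mod (gen (fun g => Exists (fun H => H g) Hs)) R.
Proof.
  intros HR HM HMs HHs. induction HHs as [|H Hs (HH & HHM & j & Hj) HHs [k Hk]].
  { exists 0. intros g Hg. exists one. split; [apply pal_prod_one|].
    replace g with (@one G); [reflexivity|]. symmetry.
    revert g Hg. apply gen_sub; [|intros x Hx; inversion Hx].
    repeat split; intros; subst; now autorewrite with grp. }
  set (K := gen (fun g => Exists (fun H => H g) Hs)) in *.
  assert (HKM : forall g, K g -> M g).
  { apply gen_sub; [easy|]. intros x Hx. rewrite Forall_forall in HHs.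
    apply Exists_exists in Hx as (L & HL & Hx). now apply (HHs L HL). }
  assert (HK : subgroup K) by apply subgroup_gen.
  destruct HH as (H1 & H2 & H3), HK as (K1 & K2 & K3).
  assert (Hdec : forall g, gen (fun g => Exists (fun H => H g) (H :: Hs)) g ->
            exists a b, H a /\ K b /\ eqm G R (a * b) g).
  { intros g Hg. induction Hg as [x Hx| |x y _ IHx _ IHy|x _ IHx].
    - inversion_clear Hx as [? ? Hx'|? ? Hx'].
      + exists x, one. rewrite mulg1. repeat split; [easy|easy|reflexivity].
      + exists one, x. rewrite mul1g. repeat split; [easy|now apply gen_in|reflexivity].
    - exists one, one. rewrite mulg1. repeat split; [easy|easy|reflexivity].
    - destruct IHx as (a & b & Ha & Hb & E), IHy as (c & d & Hc & Hd & F).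
      exists (a * c), (b * d). repeat split; [auto|auto|].
      (* The only reordering moves [c] past [b]; both lie in [M]. *)
      rewrite <- E, <- F. transitivity (a * (c * b) * d); [now grp|].
      rewrite (HM c b) by auto. now grp.
    - destruct IHx as (a & b & Ha & Hb & E).
      exists (inv a), (inv b). repeat split; [auto|auto|].
      rewrite <- E, invMg. destruct HMs as (_ & _ & M3). apply HM; auto. }
  exists (j + k). intros g Hg. destruct (Hdec g Hg) as (a & b & Ha & Hb & E).
  destruct (Hj a Ha) as (p & Hp & Ep), (Hk b Hb) as (q & Hq & Eq).
  exists (p * q). split; [now apply pal_prod_mul|]. now rewrite Ep, Eq, E.
Qed.

(** The set [[N, c]], saturated under congruence modulo [R] and cut down to [K]. The cut makes
    containment in the commutative ambient subgroup required by [bounded_mod_gen] immediate. *)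
Definition commg_image R N K c : G -> Prop :=
  fun g => K g /\ exists n, N n /\ eqm G R g (commg n c).

Lemma bounded_mod_commg_image R N K c : normal R -> bounded_mod (commg_image R N K c) R.
Proof.
  intros HR. destruct (pal_prod_commg G X HX c) as [k Hk]. exists k.
  intros g (_ & n & _ & E). exists (commg n c). split; [apply Hk|now symmetry].
Qed.

(** Since [M] is abelian modulo [R], each map [[_, x]] is a homomorphism on [M] modulo [R], so the
    sets [[M, x]] are subgroups there. Induction on a word for [g] writes [[b, g]] through these
    sets for the generators [x]. *)
Lemma bounded_mod_comm_with_G xs R M : (forall x, X x -> In x xs) ->
  normal R -> normal M ->
  (forall a b, M a -> M b -> eqm G R (a * b) (b * a)) ->
  bounded_mod (comm_with_G G M) R.
Proof.
  intros Hxs HR HM Hab.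
  assert (HMc : forall m g, M m -> M (commg m g)).
  { intros m g Hm. replace (commg m g) with (inv m * conjg m g) by grp.
    in_normal. }
  assert (Hc : forall c m n, M m -> M n -> eqm G R (conjg (commg m c) n) (commg m c)).
  { intros c m n Hm Hn. apply eqm_conjg_commute; [easy|]. auto. }
  set (Hs := map (commg_image R M M) xs).
  apply (bounded_mod_sub _ (gen (fun g => Exists (fun H => H g) Hs)));
    [|apply (bounded_mod_gen R M); [easy|easy|apply HM|]].
  - apply gen_sub; [apply subgroup_gen|].
    intros c (b & g & Hb & ->). revert b Hb.
    assert (Hx : forall x b, X x -> M b -> gen (fun g => Exists (fun H => H g) Hs) (commg b x)).
    { intros x b Hx Hb. apply gen_in, Exists_exists.
      exists (commg_image R M M x). split; [now apply in_map, Hxs|].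
      split; [now apply HMc|]. exists b. split; [easy|reflexivity]. }
    assert (Hmul : forall x y b, M b ->
      (forall b, M b -> gen (fun g => Exists (fun H => H g) Hs) (commg b x)) ->
      (forall b, M b -> gen (fun g => Exists (fun H => H g) Hs) (commg b y)) ->
      gen (fun g => Exists (fun H => H g) Hs) (commg b (x * y))).
    { intros x y b Hb IHx IHy.
      (* The element [[b, x]] is again in [M], so the hypothesis on [y] applies to [[[b, x], y]]. *)
      replace (commg b (x * y)) with (commg b y * (commg b x * commg (commg b x) y)) by grp.
      apply gen_mul; [auto|apply gen_mul; auto]. }
    revert g. apply (word_ind G X HX (fun g => forall b, M b ->
      gen (fun g => Exists (fun H => H g) Hs) (commg b g))).
    + intros b _. replace (commg b one) with (@one G) by grp. apply gen_one.
    + auto.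
    + intros x h Hxx IH b Hb. apply Hmul; [easy| |easy]. clear b Hb. intros b Hb.
      replace (commg b (inv x)) with (inv (commg (conjg b (inv x)) x)) by grp.
      apply gen_inv, Hx; [easy|]. now apply normal_conj.
  - apply Forall_forall. intros H HH. apply in_map_iff in HH as (x & <- & Hx).
    split; [|split].
    + apply subgroup_commg_image; [easy|apply HM|apply HM|auto].
    + now intros a [Ha _].
    + now apply bounded_mod_commg_image.
Qed.

(* Modulo [C] the commutators of [N] are central, so [(a, b) |-> [a, b]] is
   bilinear and [G]-invariant on [N], and the conjugates of the generators [c] can be
   moved to the left argument: [[a, c^g] = [a^(g^-1), c]]. *)
Lemma bounded_mod_derived N A C l : normal N -> normal A -> normal C ->
  (forall a b g, N a -> N b -> C (commg (commg a b) g)) ->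
  (forall a g, A a -> C (commg a g)) ->
  (forall c, In c l -> prod_set G N A c) ->
  (forall b, N b -> normal_closure (fun x => A x \/ In x l) b) ->
  bounded_mod (gen (fun c => exists a b, N a /\ N b /\ c = commg a b)) C.
Proof.
  intros HN HA HC HNc HAc Hl HNl.
  (* [Z] is the preimage in [G] of the centre of the quotient by [C]. *)
  set (Z := fun z : G => forall g, eqm G C (z * g) (g * z)).
  assert (Zeqm : forall x y, eqm G C x y -> Z x -> Z y).
  { intros x y E Hx g. now rewrite <- E. }
  assert (HZ : subgroup Z).
  { repeat split.
    - intros g. now autorewrite with grp.
    - intros x y Hx Hy g. rewrite <- mulA, (Hy g), mulA, (Hx g). now autorewrite with grp.
    - intros x Hx g. transitivity (inv x * (g * x) * inv x); [now grp|].
      rewrite <- (Hx g). now grp. }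
  assert (ZA : forall a, A a -> Z a).
  { intros a Ha g. apply eqm_commute_commg; auto. }
  assert (ZN : forall a b, N a -> N b -> Z (commg a b)).
  { intros a b Ha Hb g. apply eqm_commute_commg; auto. }
  assert (Zconj : forall z g, Z z -> eqm G C (conjg z g) z).
  { intros z g Hz. now apply eqm_conjg_commute. }
  assert (ZAl : forall n a, A a -> C (commg n a)).
  { intros n a Ha. apply eqm_commg_commute; [easy|]. symmetry. now apply ZA. }
  (* The generator [c] need not lie in [N]. Writing [c = m * a] with [m] in [N] and [a] in [A], the
     factor [[n, a]] vanishes modulo [C] and only the central [[n, m]] remains. *)
  assert (Zl : forall n c, N n -> In c l -> Z (commg n c)).
  { intros n c Hn Hc. destruct (Hl c Hc) as (m & a & Hm & Ha & ->).
    rewrite commg_mulr. apply (Zeqm (commg n m)); [|now apply ZN].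
    rewrite (proj1 (eqm_one G C _) (ZAl n a Ha)), Zconj by now apply ZN.
    now rewrite mul1g. }
  (* Adding [C] to the list makes [T] closed under congruence modulo [C]. *)
  set (Hs := C :: map (commg_image C N Z) l).
  set (T := gen (fun g => Exists (fun H => H g) Hs)).
  assert (HHs : Forall (fun H => subgroup H /\ (forall a, H a -> Z a) /\ bounded_mod H C) Hs).
  { constructor.
    - split; [apply HC|split; [|apply bounded_mod_refl]].
      intros a Ha g. apply eqm_one in Ha; [|easy]. rewrite Ha. now autorewrite with grp.
    - apply Forall_forall. intros H HH. apply in_map_iff in HH as (c & <- & Hc).
      split; [|split].
      + apply subgroup_commg_image; [easy|apply HN|easy|auto].
      + now intros a [Ha _].
      + now apply bounded_mod_commg_image. }
  assert (HT : forall x, C x -> T x).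
  { intros x Hx. apply gen_in. now left. }
  assert (Teqm : forall x y, eqm G C x y -> T x -> T y).
  { intros x y E Hx. rewrite <- (mulVKg G x y). apply gen_mul; [easy|]. now apply HT. }
  (* The induction below runs through elements of the normal closure not known to lie in [N];
     centrality of their commutators comes from membership in [T], given by the induction
     hypothesis. *)
  assert (TZ : forall x, T x -> Z x).
  { apply gen_sub; [easy|]. intros x Hx. apply Exists_exists in Hx as (H & HH & Hx).
    rewrite Forall_forall in HHs. now apply (HHs H HH). }
  apply (bounded_mod_sub _ T); [|apply (bounded_mod_gen C Z); auto].
  apply gen_sub; [apply subgroup_gen|]. intros c (a & b & Ha & Hb & ->).
  apply HNl in Hb. revert a Ha.
  induction Hb as [b (y & g & [Hy|Hy] & ->)| |x y _ IHx _ IHy|x _ IHx]; intros a Ha.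
  - apply HT, ZAl. now apply normal_conj.
  - apply (Teqm (commg (conjg a (inv g)) y)).
    + symmetry. replace (commg a (conjg y g)) with (conjg (commg (conjg a (inv g)) y) g) by grp.
      apply Zconj, Zl; [now apply normal_conj|easy].
    + apply gen_in. right. apply Exists_exists. exists (commg_image C N Z y).
      split; [now apply in_map|]. split; [apply Zl; [now apply normal_conj|easy]|].
      exists (conjg a (inv g)). split; [now apply normal_conj|reflexivity].
  - replace (commg a one) with (@one G) by grp. apply gen_one.
  - apply (Teqm (commg a y * commg a x)); [|apply gen_mul; [now apply IHy|now apply IHx]].
    rewrite commg_mulr, Zconj by auto. reflexivity.
  - apply (Teqm (inv (commg a x))); [|now apply gen_inv, IHx].
    rewrite commg_invr, Zconj by auto. reflexivity.
Qed.

(* Words in the single letter [x] evaluate to powers, which are palindromes. *)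
Lemma palindrome_cyclic x : X x -> forall g, gen (eq x) g -> palindrome X g.
Proof.
  intros Hx.
  (* One sign [b] shared by all letters keeps the word reduced. The work lies in showing that such
     powers are closed under products, where opposite signs cancel, and under inverses. *)
  set (P := fun g => exists m b, g = eval_word (repeat (x, b) m)).
  assert (HP : forall b g, P g -> P (eval_letter (x, b) * g)).
  { intros b g (m & c & ->). destruct (Bool.bool_dec b c) as [->|Hbc].
    - exists (S m), c. reflexivity.
    - destruct m as [|m].
      + exists 1, b. reflexivity.
      + exists m, c. unfold eval_word. simpl.
        destruct b, c; try easy; unfold eval_letter; simpl; now rewrite ?mulKg, ?mulVKg. }
  assert (HPr : forall b m g, P g -> P (eval_word (repeat (x, b) m) * g)).
  { intros b m g Hg. induction m as [|m IH].
    - unfold eval_word. simpl. now rewrite mul1g.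
    - unfold eval_word in *. simpl. rewrite <- mulA. now apply HP. }
  assert (HPi : forall b m, inv (eval_word (repeat (x, b) m)) = eval_word (repeat (x, negb b) m)).
  { intros b m. induction m as [|m IH].
    - apply invg1.
    - replace (repeat (x, b) (S m)) with (repeat (x, b) m ++ [(x, b)])
        by (symmetry; apply (repeat_cons m (x, b))).
      rewrite eval_word_app, invMg, IH.
      replace (inv (eval_word [(x, b)])) with (eval_letter (x, negb b)); [reflexivity|].
      unfold eval_word. simpl. rewrite mulg1. now apply eval_cancels. }
  intros g Hg.
  assert (Pg : P g).
  { revert g Hg. apply gen_sub; [repeat split|].
    - now exists 0, true.
    - intros g h (m & b & ->) Hh. now apply HPr.
    - intros g (m & b & ->). exists m, (negb b). apply HPi.
    - intros g <-. exists 1, false. symmetry. unfold eval_word. simpl. apply mulg1. }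
  destruct Pg as (m & b & ->). exists (repeat (x, b) m). repeat split.
  - apply Forall_forall. intros a Ha. apply repeat_spec in Ha. now subst.
  - clear. induction m as [|[|m] IH]; simpl; auto. split; [|exact IH].
    intros [_ E]. now destruct b.
  - apply rev_repeat.
Qed.

(** Modulo the derived subgroup [G] is the product of the finitely many cyclic subgroups generated
    by the letters, and one palindrome per letter suffices. *)
Lemma bounded_mod_abelianization xs : (forall x, In x xs <-> X x) ->
  bounded_mod (fun _ => True) (@derived G 1).
Proof.
  intros Hxs. set (Hs := map (fun x => gen (eq x)) xs).
  apply (bounded_mod_sub _ (gen (fun g => Exists (fun H => H g) Hs))).
  - assert (HT : forall x, X x -> gen (fun g => Exists (fun H => H g) Hs) x).
    { intros x Hx. apply gen_in, Exists_exists. exists (gen (eq x)).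
      split; [now apply in_map_iff; exists x; split; [|apply Hxs]|now apply gen_in]. }
    intros g _. revert g. apply (word_ind G X HX).
    + apply gen_one.
    + intros x g Hx Hg. apply gen_mul; auto.
    + intros x g Hx Hg. apply gen_mul; [apply gen_inv|]; auto.
  - apply (bounded_mod_gen _ (fun _ => True)); [apply normal_derived| |now repeat split|].
    + intros a b _ _. apply eqm_commute_commg; [apply normal_derived|].
      apply gen_in. now exists a, b.
    + apply Forall_forall. intros H HH. apply in_map_iff in HH as (x & <- & Hx).
      split; [apply subgroup_gen|split; [easy|]].
      exists 1. intros g Hg. exists g. split.
      * now apply pal_prod_palindrome, (palindrome_cyclic x); [apply Hxs|].
      * pose proof (normal_derived G 1). reflexivity.
Qed.

(** * Descent along the derived series *)

Lemma bounded_mod_derived_succ xs A n : (forall x, In x xs <-> X x) ->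
  normal A -> quotient_max_n A ->
  bounded_mod (derived (S n))
    (prod_set G (derived (S (S n))) (comm_with_G G A)).
Proof.
  intros Hxs HA Hmax.
  set (D := comm_with_G G A). set (R := prod_set G (derived (S (S n))) D).
  assert (HD : normal D) by apply normal_comm_with_G, HA.
  pose proof (normal_derived G n) as HN.
  pose proof (normal_derived G (S n)) as HN'.
  pose proof (normal_derived G (S (S n))) as HN''.
  assert (HR : normal R) by now apply normal_prod_set.
  set (M := comm_with_G G (derived (S n))).
  assert (HM : normal M) by now apply normal_comm_with_G.
  (* The maximal condition concerns normal subgroups containing [A], so it is applied to the product
     of [derived n] with [A]. *)
  destruct (Hmax (prod_set G (derived n) A)) as [l Hl].
  { now apply normal_prod_set. }
  { intros a Ha. now apply prod_set_r. }
  (* Modulo [M R] the commutators of [derived n] are central, as is [A]. The remaining factor [M] is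
     bounded modulo [R] because [derived (S n)] is abelian modulo [R]. *)
  apply (bounded_mod_trans _ (prod_set G M R)).
  - apply (bounded_mod_derived (derived n) A _ l); try easy.
    + now apply normal_prod_set.
    + intros a b g Ha Hb. apply prod_set_l; [easy|]. apply gen_in.
      exists (commg a b), g. split; [|easy]. apply gen_in. now exists a, b.
    + intros a g Ha. apply prod_set_r; [easy|]. apply prod_set_r; [easy|].
      apply gen_in. now exists a, g.
    + intros c Hc. apply Hl, gen_in. exists c, one. split; [now right|]. grp.
    + intros b Hb. apply Hl. now apply prod_set_l.
  - apply bounded_mod_prod_set; [easy|easy|].
    apply (bounded_mod_comm_with_G xs); [apply Hxs|easy|easy|].
    intros a b Ha Hb. apply eqm_commute_commg; [easy|]. apply prod_set_l; [easy|].
    apply gen_in. now exists a, b.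
Qed.

(** The index starts at [S n] because the descent step begins at the derived subgroup; the top
    quotient is handled by the abelianization. *)
Lemma bounded_mod_derived_series xs A n : (forall x, In x xs <-> X x) ->
  normal A -> quotient_max_n A ->
  bounded_mod (fun _ => True) (prod_set G (derived (S n)) (comm_with_G G A)).
Proof.
  intros Hxs HA Hmax.
  assert (HD : normal (comm_with_G G A)) by apply normal_comm_with_G, HA.
  induction n as [|n IH].
  - apply (bounded_mod_sub_r _ (derived 1)).
    + intros g Hg. now apply prod_set_l.
    + now apply (bounded_mod_abelianization xs).
  - apply (bounded_mod_trans _ _ _ IH).
    apply bounded_mod_prod_set.
    + apply normal_prod_set; [apply normal_derived|easy].
    + intros g Hg. apply prod_set_r; [apply normal_derived|easy].
    + now apply (bounded_mod_derived_succ xs).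
Qed.

End Bounded.

Theorem theorem1p1 (G : group) (X : G -> Prop) (A : G -> Prop) :
  solvable G -> finite_set X -> generates X ->
  normal A -> abelian_sub A -> quotient_max_n A ->
  pw_finite X.
Proof.
  intros [n Hn] [xs Hxs] HX HA HAab Hmax.
  assert (Hxs' : forall x, In x xs <-> X x) by (intros x; now rewrite Hxs).
  assert (Hone : normal (fun g : G => g = one)).
  { repeat split; intros; subst; now grp. }
  (* [derived (S n)] lies in the trivial [derived n], so the product reduces to [[A, G]]. That is
     bounded modulo the trivial subgroup since [A] is abelian. *)
  destruct (bounded_mod_trans G X (fun _ => True) (prod_set G (derived (S n)) (comm_with_G G A))
    (fun g => g = one)) as [k Hk].
  - now apply (bounded_mod_derived_series G X HX xs).
  - apply (bounded_mod_sub _ _ _ (comm_with_G G A)).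
    + intros g (h & c & Hh & Hc & ->).
      rewrite (Hn h) by now apply derived_succ_sub. now rewrite mul1g.
    + apply (bounded_mod_comm_with_G G X HX xs); [apply Hxs'|easy|easy|].
      intros a b Ha Hb. unfold eqm. rewrite (HAab a b) by easy. apply mulVg.
  (* Congruence modulo the trivial subgroup is equality. *)
  - exists k. intros g. destruct (Hk g I) as (p & (ps & L & F & <-) & E).
    exists ps. repeat split; [easy|easy|].
    unfold eqm in E. apply invg_unique in E. now rewrite E, invgK.
Qed.
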